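(* Let $\{\mu_\theta\}_{\theta\in\Theta}$ be a family of Borel probability measures on $\mathbb{R}^d$ and let $\mu_{\mathrm{mix}}$ be its mixture with respect to a mixing probability measure $m$ on $\Theta$. Suppose that the measures $\mu_\theta$ satisfy the log-Sobolev inequality with uniformly bounded constants: $$C_\Theta:=\sup_{\theta\in\Theta}C_{\mathrm{LS}}(\mu_\theta)<\infty .$$ Suppose moreover that $$M_\Theta:=\sup_{\theta,\theta'\in\Theta}\chi^2(\mu_\theta\Vert\mu_{\theta'})<\infty .$$ Then $\mu_{\mathrm{mix}}$ satisfies the log-Sobolev inequality with $$C_{\mathrm{LS}}(\mu_{\mathrm{mix}})\le C_\Theta\cdot\Bigl(2+\tfrac14(2+M_\Theta)\log(1+M_\Theta)\Bigr).$$
   Context: Mixture: $(\Theta,\mathfrak{M},m)$ is a probability space, for every Borel set $A\subset\mathbb{R}^d$ the map $\theta\mapsto\mu_\theta(A)$ is measurable, and $\mu_{\mathrm{mix}}(A):=\int_\Theta \mu_\theta(A)\,dm(\theta)$ for Borel $A\subset\mathbb{R}^d$. $\chi^2(\mu_1\Vert\mu_2):=\int\bigl(\frac{d\mu_1}{d\mu_2}-1\bigr)^2d\mu_2$ if $\mu_1\ll\mu_2$ and $+\infty$ otherwise. $\mathrm{Ent}_\mu(f^2):=\int f^2\log(f^2)\,d\mu-\int f^2d\mu\,\log\bigl(\int f^2d\mu\bigr)$. A probability measure $\mu$ on $\mathbb{R}^d$ satisfies the log-Sobolev inequality with constant $C\in(0,\infty)$ if $$\mathrm{Ent}_\mu(f^2)\le2C\int_{\mathbb{R}^d}|\nabla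 f|^2\,d\mu$$ for all sufficiently smooth ($C^1$) functions $f:\mathbb{R}^d\to\mathbb{R}$. $C_{\mathrm{LS}}(\mu)$ is the optimal such constant (infimum; $+\infty$ if there is none). Convention: an estimate $A\le B$ means that if $B<\infty$, then $A$ is well defined (in particular $f\in L^2(\mu)$) and the inequality holds. *)

(* Defs.v *)
From HB Require Import structures.
From mathcomp Require Import all_boot all_order all_algebra.
From mathcomp Require Import all_classical all_reals all_analysis.
From mathcomp Require Import measurable_realfun.

Set Implicit Arguments.
Unset Strict Implicit.
Unset Printing Implicit Defensive.

Import Order.TTheory GRing.Theory Num.Theory.
Import numFieldNormedType.Exports.

Local Open Scope classical_set_scope.
Local Open Scope ring_scope.
Local Open Scope charge_scope.
Local Open Scope ereal_scope.

(* The carrier is 'rV[R]_d itself, so functions on 'rV[R]_d can be integrated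
   directly; the topology of the (max) norm of 'rV[R]_d is the Euclidean one. *)
Notation borel_rV R d := (g_sigma_algebraType (@open 'rV[R]_d)).

Section mixture.
Context {dT dX : measure_display} {T : measurableType dT}
  {X : measurableType dX} {R : realType}.
Variable mu : T -> probability X R.

Definition measurable_family :=
  forall A : set X, measurable A -> measurable_fun [set: T] (mu ^~ A).

Variable mmu : measurable_family.
Variable m : probability T R.

(* The measurability proof is an argument so that [mixture m mmu] can carry a
   canonical structure of probability measure. *)
Definition mixture of measurable_family : set X -> \bar R :=
  fun A => \int[m]_t mu t A.

Let mix := mixture mmu.

Let mix0 : mix set0 = 0.
Proof.
rewrite /mix /mixture (eq_integral (cst 0)) ?integral0// => t _.
by rewrite measure0.
Qed.

Let mix_ge0 A : 0 <= mix A.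
Proof. exact: integral_ge0. Qed.

Let mix_sigma_additive : semi_sigma_additive mix.
Proof.
move=> F mF tF mUF; rewrite [X in _ --> X](_ : _ =
    \int[m]_t (\sum_(n <oo) mu t (F n))); last first.
  apply: eq_integral => t _.
  by apply/esym/cvg_lim => //; exact/measure_semi_sigma_additive.
apply/cvg_closeP; split.
  by apply: is_cvg_nneseries => n _ _; exact: integral_ge0.
rewrite closeE// integral_nneseries// => n.
exact: mmu.
Qed.

HB.instance Definition _ := isMeasure.Build _ _ _ (mixture mmu)
  mix0 mix_ge0 mix_sigma_additive.

Let mix_setT : mix setT = 1.
Proof.
rewrite /mix /mixture (eq_integral (cst 1)); last first.
  by move=> t _; rewrite probability_setT.
by rewrite integral_cst// mul1e; exact: probability_setT.
Qed.

HB.instance Definition _ := Measure_isProbability.Build _ _ _ (mixture mmu)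
  mix_setT.

End mixture.

Definition chi2 {dX : measure_display} {X : measurableType dX} {R : realType}
    (mu1 mu2 : probability X R) : \bar R :=
  if `[< mu1 `<< mu2 >] then
    \int[mu2]_x (('d (charge_of_finite_measure mu1) '/d mu2) x - 1) ^+ 2
  else +oo.

(* The convention 0 log 0 = 0 holds for both terms: [ln 0 = 0] in R, and
   [0 * lne 0 = 0 * -oo = 0] in \bar R. *)
Definition Ent {dX : measure_display} {X : measurableType dX} {R : realType}
    (mu : probability X R) (g : X -> R) : \bar R :=
  \int[mu]_x (g x * ln (g x))%:E -
  (\int[mu]_x (g x)%:E) * lne (\int[mu]_x (g x)%:E).

Section log_sobolev.
Context {R : realType} {d : nat}.
Implicit Types (f : 'rV[R]_d -> R) (mu : probability (borel_rV R d) R).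

Definition gradient f (x : 'rV[R]_d) : 'rV[R]_d :=
  (\row_i 'D_(delta_mx 0 i) f x)%R.

Definition C1 f :=
  (forall x, differentiable f x) /\ continuous (gradient f).

(* The library norm of 'rV[R]_d is the max norm, hence the explicit sum. *)
Definition sqr_norm_gradient f (x : 'rV[R]_d) : R :=
  (\sum_(i < d) gradient f x ord0 i ^+ 2)%R.

(* An estimate A <= B is understood as: if B is finite, then A is well defined
   (in particular f is in L^2(mu)) and the inequality holds. For f in L^2(mu),
   [Ent mu (f ^+ 2)] is never an undefined +oo - oo, as x ln x >= - e^-1. *)
Definition log_sobolev mu (C : R) :=
  forall f, C1 f ->
    \int[mu]_x (sqr_norm_gradient f x)%:E < +oo ->
    f \in Lfun mu 2%:E /\
    Ent mu (fun x => f x ^+ 2)%R <=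
      (2 * C)%:E * \int[mu]_x (sqr_norm_gradient f x)%:E.

Definition C_LS mu : \bar R :=
  ereal_inf [set C%:E | C in [set C : R | (0 < C)%R /\ log_sobolev mu C]].

End log_sobolev.

(* Main.v *)
Require Import Defs.
From HB Require Import structures.
From mathcomp Require Import all_boot all_order all_algebra.
From mathcomp Require Import all_classical all_reals all_analysis.
From mathcomp Require Import measurable_realfun ring lra.

(** Why the theorem holds.  Let [f] be [C1] with finite Dirichlet energy
    [E = int |grad f|^2] under the mixture, and write [E_t] for its energy
    under [mu_t], so that [E] is the average of the [E_t].

    For [A > 0] the function [f^2 ln (f^2 / A) - f^2 + A] is nonnegative, and
    its integral under any probability bounds the entropy of [f^2], with
    equality when [A] is the mean of [f^2].  Being nonnegative it can be
    integrated over a mixture fibre by fibre.  It is thus enough to find one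
    [A], common to all [t], such that its integral under [mu_t] is at most
    [2 C (2 + M / 2) E_t].

    Put [m_t = int |f| dmu_t], [g_t = int f^2 dmu_t] and [s_t = g_t - m_t^2].
    The integral under [mu_t] is the sum of three terms:
      [Ent_t (f^2)], which is at most [2 C E_t] by the log-Sobolev inequality;
      [g_t ln (g_t / m_t^2)], which is at most [Ent_t (f^2)]
        ([entropy_tangent]);
      [g_t ln (m_t^2 / A) - g_t + A], which has to be at most [M C E_t].

    For the third term, the bound on the chi-square divergence and the
    Cauchy-Schwarz inequality give [(m_t' - m_t)^2 <= M s_t]
    ([chi2_mean_diff]).  So if [x] and [y] are the infimum and the supremum of
    the means, both [m_t - x] and [y - m_t] are at most [sqrt (M s_t)].  For
    [A = (x^2 + y^2) / 2], the inequality [ln z <= z - 1] and a polynomial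
    inequality ([quartic_gap_le]) bound the third term by [M s_t].  Finally
    [s_t <= C E_t], the Poincare inequality implied by the log-Sobolev
    inequality ([log_sobolev_poincare]).

    This yields the constant [C (2 + M / 2)] for the mixture, and
    [2 M <= (2 + M) ln (1 + M)]. *)

Set Implicit Arguments.
Unset Strict Implicit.
Unset Printing Implicit Defensive.
Import Order.TTheory GRing.Theory Num.Theory.
Import numFieldNormedType.Exports.
Local Open Scope classical_set_scope.
Local Open Scope ring_scope.

(** * Inequalities in real numbers *)

Section real_inequalities.
Context {R : realType}.
Implicit Types a c g m x y z : R.

Lemma ln_le_subr1 z : 0 < z -> ln z <= z - 1.
Proof. by move=> z0; rewrite -{1}[z](subrKC 1) le_ln1Dx//; lra. Qed.

(** The tangent line at [c] of the convex function [y ln y]. *)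
Lemma xln_ge_tangent y c : 0 <= y -> 0 < c -> y * (ln c + 1) - c <= y * ln y.
Proof.
rewrite le_eqVlt => /predU1P[<-|y0] c0; first by rewrite !mul0r; lra.
have := ln_le_subr1 (divr_gt0 c0 y0); rewrite ln_div ?posrE// => h.
have : y * (ln c - ln y) <= y * (c / y - 1) by rewrite ler_pM2l.
have -> : y * (c / y - 1) = c - y by field; lra.
lra.
Qed.

(** [(2 + t) ln (1 + t) - 2 t] vanishes at [0] and its derivative,
    [ln z + 1 / z - 1] in terms of [z = 1 + t], is nonnegative. *)
Lemma ln1p_ge (t : R) : 0 <= t -> 2 * t <= (2 + t) * ln (1 + t).
Proof.
move=> t0; pose F := fun z : R => (1 + z) * ln z - 2 * z.
pose dF := fun z : R => ln z + z^-1 - 1.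
have F' (z : R) : 0 < z -> is_derive z 1 F (dF z).
  move=> z0; have ? := is_derive1_ln z0.
  rewrite /F; apply: is_derive_eq.
  rewrite /GRing.scale/=.
  by rewrite /dF; field; lra.
have [||c + e] := @MVT_segment _ F dF 1 (1 + t) ltac:(lra) _ _.
- by move=> x; rewrite in_itv/= => /andP[x1 _]; apply: F'; lra.
- apply: derivable_within_continuous => z.
  by rewrite in_itv/= => /andP[az _]; have [] := F' z (lt_le_trans ltr01 az).
rewrite in_itv/= => /andP[c1 _].
have c0 : 0 < c by lra.
have dF0 : 0 <= dF c.
  have := @ln_le_subr1 c^-1; rewrite invr_gt0 lnV ?posrE// => /(_ c0).
  by rewrite /dF; lra.
have : 0 <= dF c * (1 + t - 1) by rewrite mulr_ge0//; lra.
by rewrite -e /F ln1; lra.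
Qed.

(** [ln z - z + (z - 1)^2 / 2] has derivative [(z - 1)^2 / z], which is at most
    [2 t^2] between [1] and [1 + t] because these numbers are at least [1/2]. *)
Lemma ln_ge_cubic (t : R) : `|t| <= 2^-1 ->
  t - t ^+ 2 / 2 - 2 * `|t| ^+ 3 <= ln (1 + t).
Proof.
move=> t2; pose F := fun z : R => ln z - z + 2^-1 * (z - 1) ^+ 2.
pose dF := fun z : R => (z - 1) ^+ 2 / z.
have F' z : 0 < z -> is_derive z 1 F (dF z).
  move=> z0; have ? := is_derive1_ln z0.
  rewrite /F; apply: is_derive_eq.
  rewrite /GRing.scale/=.
  by rewrite /dF; field; lra.
have t1 : -2^-1 <= t by have := ler_norm (- t); rewrite normrN; lra.
have Fcont a b : 0 < a -> {within `[a, b], continuous F}.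
  move=> a0; apply: derivable_within_continuous => z.
  by rewrite in_itv/= => /andP[az _]; have [] := F' z (lt_le_trans a0 az).
have F1 : F 1 = -1 by rewrite /F ln1 subrr expr0n/=; lra.
suff : - 1 - 2 * `|t| ^+ 3 <= F (1 + t) by rewrite /F (addrC 1 t) addrK; lra.
have [t0|t0] := leP 0 t.
  have [|c + e] := @MVT_segment _ F dF 1 (1 + t) ltac:(lra) _ (Fcont _ _ ltr01).
    by move=> x; rewrite in_itv/= => /andP[x1 _]; apply: F'; lra.
  rewrite in_itv/= => /andP[c1 c2].
  have : 0 <= dF c * (1 + t - 1).
    by rewrite mulr_ge0 ?divr_ge0 ?sqr_ge0//; lra.
  have : 0 <= `|t| ^+ 3 by rewrite exprn_ge0.
  lra.
have [||c + e] := @MVT_segment _ F dF (1 + t) 1 ltac:(lra) _ _.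
- by move=> x; rewrite in_itv/= => /andP[x1 _]; apply: F'; lra.
- by apply: Fcont; lra.
rewrite in_itv/= => /andP[c1 c2].
have : dF c <= 2 * t ^+ 2.
  rewrite /dF ler_pdivrMr; last by lra.
  have : (c - 1) ^+ 2 <= t ^+ 2 by nra.
  have := sqr_ge0 t; nra.
rewrite ltr0_norm//.
have e1 : 1 - (1 + t) = - t by lra.
rewrite e1 in e.
nra.
Qed.

(** Second order expansion at [1] of [z^2 ln z^2 - z^2 + 1], in a form that is
    valid on the whole line: for [|t| > 1/2] the left-hand side is negative
    while the right-hand side never is. *)
Lemma xlnx_sqr_ge_cubic (t : R) :
  2 * t ^+ 2 - 10 * `|t| ^+ 3 <=
  (1 + t) ^+ 2 * ln ((1 + t) ^+ 2) - (1 + t) ^+ 2 + 1.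
Proof.
have [t2|t2] := leP `|t| 2^-1; last first.
  have h := xln_ge_tangent (sqr_ge0 (1 + t)) (@ltr01 R).
  rewrite ln1 in h.
  have -> : t ^+ 2 = `|t| ^+ 2 by rewrite real_normK// num_real.
  have : 0 <= `|t| ^+ 2 * (10 * `|t| - 2) by apply: mulr_ge0; [exact: sqr_ge0|lra].
  lra.
have t1 : 0 < 1 + t by have := ler_norm (- t); rewrite normrN; lra.
rewrite lnXn// -mulr_natl.
have h := @ln_ge_cubic t t2.
have h2 : (1 + t) ^+ 2 * (2 * (t - t ^+ 2 / 2 - 2 * `|t| ^+ 3)) <=
    (1 + t) ^+ 2 * (2 * ln (1 + t)).
  by rewrite ler_pM2l ?exprn_gt0// ler_pM2l.
apply: (@le_trans _ _ ((1 + t) ^+ 2 * (2 * (t - t ^+ 2 / 2 - 2 * `|t| ^+ 3)) -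
    (1 + t) ^+ 2 + 1)); last by lra.
have ts : t <= `|t| by exact: ler_norm.
have e2 : t ^+ 2 = `|t| ^+ 2 by rewrite real_normK// num_real.
have s0 : 0 <= `|t| by exact: normr_ge0.
move: (`|t|) ts e2 s0 t2 {h h2} => s ts e2 s0 t2.
have e4 : t ^+ 4 = s ^+ 4 by rewrite -[4%N]/(2 * 2)%N !exprM e2.
have h3 : (1 + t) ^+ 2 * s ^+ 3 <= (1 + s) ^+ 2 * s ^+ 3.
  by rewrite ler_wpM2r ?exprn_ge0// lerXn2r ?nnegrE//; lra.
have h4 : 0 <= s ^+ 3 * (10 - s - 4 * (1 + s) ^+ 2).
  by apply: mulr_ge0; [exact: exprn_ge0| nra].
have -> : (1 + t) ^+ 2 * (2 * (t - t ^+ 2 / 2 - 2 * s ^+ 3)) - (1 + t) ^+ 2 + 1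
  = 2 * t ^+ 2 - t ^+ 4 - 4 * ((1 + t) ^+ 2 * s ^+ 3) by field.
lra.
Qed.

(** The left-hand side is nonincreasing in [g] since [m^2 <= 2 A], so it is at
    most [(m^2 - A)^2].  For [m] in the upper half of [[x, y]] this compares
    with [m - x], for [m] in the lower half with [y - m]; the choice of [A]
    makes [sqrt A] lie between [(x + y) / 2] and [y]. *)
Lemma quartic_gap_le x y A m g b : A = (x ^+ 2 + y ^+ 2) / 2 ->
  0 <= x -> x <= m -> m <= y -> m ^+ 2 <= g ->
  (m - x) ^+ 2 <= b -> (y - m) ^+ 2 <= b ->
  g * m ^+ 2 - 2 * A * g + A ^+ 2 <= A * b.
Proof.
move=> AE x0 xm my mg bx by_.
have Ay : 0 <= 2 * A - m ^+ 2 by rewrite AE; nra.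
suff : (m ^+ 2 - A) ^+ 2 <= A * b.
  have := mulr_ge0 Ay (_ : 0 <= g - m ^+ 2); rewrite subr_ge0 => /(_ mg); nra.
have A0 : 0 <= A by rewrite AE; nra.
pose a := Num.sqrt A.
have a0 : 0 <= a by exact: sqrtr_ge0.
have aA : a ^+ 2 = A by rewrite sqr_sqrtr.
have ua : (x + y) / 2 <= a.
  rewrite -(@ler_pXn2r _ 2)// ?nnegrE ?aA ?AE; [nra|lra].
have ay : a <= y.
  rewrite -(@ler_pXn2r _ 2)// ?nnegrE ?aA ?AE; [nra|lra].
have [ym|ym] := leP (m - x) (y - m).
  apply: (@le_trans _ _ (A * (y - m) ^+ 2)); last by rewrite ler_wpM2l.
  rewrite -aA -exprMn.
  have mu : m ^+ 2 <= a ^+ 2 by rewrite ler_pXn2r ?nnegrE//; lra.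
  rewrite -sqrrN opprB ler_pXn2r ?nnegrE ?subr_ge0 ?mulr_ge0 ?subr_ge0//.
  suff : 0 <= m ^+ 2 - a * m + a * y - a ^+ 2 by lra.
  (* In [m] this quadratic is least at [a / 2], which may fall below [x]. *)
  have [xa|xa] := leP (a / 2) x.
    have : 0 <= (m - x) * (m + x - a) by apply: mulr_ge0; lra.
    have : a ^+ 2 - x ^+ 2 <= a * (y - x).
      have -> : a ^+ 2 - x ^+ 2 = (x + y) / 2 * (y - x) by rewrite aA ?AE; field.
      by rewrite ler_wpM2r//; lra.
    lra.
  have ay' : a * 5 <= y * 4.
    rewrite -(@ler_pXn2r _ 2)// ?nnegrE ?mulr_ge0//; last lra.
    have : x ^+ 2 <= (a / 2) ^+ 2 by rewrite ler_pXn2r ?nnegrE//; lra.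
    by rewrite !exprMn aA ?AE; have := sqr_ge0 y; lra.
  have : 0 <= a * (y * 4 - a * 5) by rewrite mulr_ge0// subr_ge0.
  have := sqr_ge0 (m - a / 2).
  lra.
apply: (@le_trans _ _ (A * (m - x) ^+ 2)); last by rewrite ler_wpM2l.
rewrite -aA -exprMn -real_normK ?num_real//.
rewrite ler_pXn2r ?nnegrE ?mulr_ge0 ?subr_ge0// ler_norml.
have uam : (x + y) / 2 * (m - x) <= a * (m - x).
  by rewrite ler_wpM2r// subr_ge0.
have := mulr_ge0 (_ : 0 <= y - m) (_ : 0 <= m - x).
rewrite !subr_ge0 => /(_ my xm); rewrite aA ?AE.
move=> h; apply/andP; split; nra.
Qed.

(** In the application [m] and [g] are the first two moments of [|f|] and [I] is
    the integral of [f^2 ln f^2], so that [I - g ln g] is the entropy of [f^2].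
    The bound on [I] at [a = g / m] says that [g ln (g / m^2)] is at most this
    entropy; what is left is controlled by [quartic_gap_le]. *)
Lemma entropy_gap_le x y A m g b e I : A = (x ^+ 2 + y ^+ 2) / 2 -> 0 < A ->
  0 <= x -> x <= m -> m <= y -> m ^+ 2 <= g ->
  (m - x) ^+ 2 <= b -> (y - m) ^+ 2 <= b ->
  (forall a : R, 0 < a -> 2 * (g * (ln a + 1) - a * m) <= I) ->
  I - g * ln g <= e ->
  I - g * ln A - g + A <= 2 * e + b.
Proof.
move=> AE A0 x0 xm my mg bx by_ Ia Ie.
have := quartic_gap_le AE x0 xm my mg bx by_.
have : 0 <= m by lra.
rewrite le_eqVlt => /predU1P[m0|m0].
  have g0 : g = 0.
    apply/eqP; rewrite eq_le (le_trans (sqr_ge0 _) mg) andbT leNgt; apply/negP => g0.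
    (* At this point the bound would read [I + 2 g <= I]. *)
    have := Ia _ (expR_gt0 (I / (2 * g))); rewrite expRK -m0 mulr0.
    have -> : 2 * (g * (I / (2 * g) + 1) - 0) = I + 2 * g by field; lra.
    lra.
  have := Ia 1 ltr01; rewrite ln1 g0 !mul0r in Ie *.
  have x00 : x = 0 by lra.
  by move: AE by_; rewrite x00 -m0 subr0 expr0n/=; lra.
have g0 : 0 < g := lt_le_trans (exprn_gt0 2 m0) mg.
have := Ia (g / m) (divr_gt0 g0 m0).
rewrite ln_div ?posrE// divfK ?gt_eqF// => Igm.
have : g * (ln (m ^+ 2 / A)) <= g * (m ^+ 2 / A - 1).
  by rewrite ler_pM2l// ln_le_subr1// divr_gt0// exprn_gt0.
rewrite ln_div ?posrE ?exprn_gt0// lnXn// => lA qA.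
have : (g * m ^+ 2 - 2 * A * g + A ^+ 2) / A <= b by rewrite ler_pdivrMr// [b * A]mulrC.
have -> : (g * m ^+ 2 - 2 * A * g + A ^+ 2) / A = g * (m ^+ 2 / A - 1) - g + A.
  by field; lra.
rewrite -mulr_natl in lA; lra.
Qed.

(** The case of mean [0]: large values of [a] force [g = 0]. *)
Lemma entropy_gap_le_mean0 A g e I : 0 <= g ->
  (forall a : R, 0 < a -> 2 * (g * (ln a + 1)) <= I) ->
  I - g * ln g <= e ->
  I - g * ln A - g + A <= 2 * e + A.
Proof.
move=> g0 Ia Ie.
have g00 : g = 0.
  apply/eqP; rewrite eq_le g0 andbT leNgt; apply/negP => {}g0.
  (* At this point the bound would read [I + 2 g <= I]. *)
  have := Ia _ (expR_gt0 (I / (2 * g))); rewrite expRK.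
  have -> : 2 * (g * (I / (2 * g) + 1)) = I + 2 * g by field; lra.
  lra.
have := Ia 1 ltr01; subst g; rewrite ln1; lra.
Qed.

End real_inequalities.

Section dispersion.
Context {R : realType} {I : Type}.

(** [r i] bounds the squared distance from [v i] to all other values, hence to
    their infimum [x] and supremum [y]. *)
Lemma dispersion_bounds (G : set I) (v r : I -> R) : G !=set0 ->
  (forall i, G i -> 0 <= v i) ->
  (forall i j, G i -> G j -> (v j - v i) ^+ 2 <= r i) ->
  exists x y : R, 0 <= x /\ forall i, G i ->
    [/\ x <= v i, v i <= y, (v i - x) ^+ 2 <= r i & (y - v i) ^+ 2 <= r i].
Proof.
move=> [i0 Gi0] v0 vr.
have Sv : [set v i | i in G] !=set0 by exists (v i0), i0.
have near i j : G i -> G j -> `|v j - v i| <= Num.sqrt (r i).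
  by move=> Gi Gj; rewrite -sqrtr_sqr ler_wsqrtr// vr.
have rE i : G i -> Num.sqrt (r i) ^+ 2 = r i.
  by move=> Gi; rewrite sqr_sqrtr// (le_trans _ (vr i i Gi Gi))// sqr_ge0.
have ubS i : G i -> ubound [set v i | i in G] (v i + Num.sqrt (r i)).
  by move=> Gi _ [j Gj <-]; have := near i j Gi Gj; rewrite ler_norml; lra.
have lbS i : G i -> lbound [set v i | i in G] (v i - Num.sqrt (r i)).
  by move=> Gi _ [j Gj <-]; have := near i j Gi Gj; rewrite ler_norml; lra.
exists (inf [set v i | i in G]), (sup [set v i | i in G]); split.
  by apply: lb_le_inf => // _ [j Gj <-]; exact: v0.
move=> i Gi.
have xv : inf [set v i | i in G] <= v i.
  by apply: ge_inf; [exists 0 => _ [j Gj <-]; exact: v0|exists i].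
have vy : v i <= sup [set v i | i in G].
  by apply: ub_le_sup; [exists (v i + Num.sqrt (r i)); exact: ubS|exists i].
have xl := lb_le_inf Sv (lbS i Gi).
have yu := ge_sup Sv (ubS i Gi).
split=> //; rewrite -(rE i Gi) ler_pXn2r ?nnegrE ?sqrtr_ge0//; lra.
Qed.

End dispersion.

(** * Square-integrable functions on a probability space *)

Section square_integrable.
Context d (X : measurableType d) (R : realType) (P : probability X R).
Implicit Types f g h : X -> R.
Local Notation integrable := (P.-integrable setT).

Lemma integrable_sqr_Lfun2 f : measurable_fun setT f ->
  integrable (fun x => (f x ^+ 2)%:E) -> f \in Lfun P 2%:E.
Proof.
move=> mf /integrable_lty; rewrite inE => fi.
apply/andP; split; rewrite inE//= /finite_norm unlock poweR_lty//.
under eq_integral do rewrite /= powR_mulrn// real_normK ?num_real//.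
exact: fi measurableT.
Qed.

Lemma Lfun2_integrable f : f \in Lfun P 2%:E -> integrable (EFin \o f).
Proof.
move=> f2; apply/Lfun1_integrable; apply: Lfun_subset12 => //.
exact: fin_num_measure.
Qed.

Lemma integral_probability_cst (c : \bar R) : (\int[P]_x c = c)%E.
Proof.
rewrite integral_cst// [X in (c * X)%E](_ : _ = 1%E) ?mule1//.
exact: probability_setT.
Qed.

Lemma Rintegral_probability_cst (c : R) : \int[P]_x c = c.
Proof.
rewrite Rintegral_cst// [X in fine X](_ : _ = 1%E) ?mulr1//.
exact: probability_setT.
Qed.

Lemma integrable_mul f g : f \in Lfun P 2%:E -> g \in Lfun P 2%:E ->
  integrable (fun x => (f x * g x)%:E).
Proof. by move=> f2 g2; apply/Lfun1_integrable; exact: Lfun2_mul_Lfun1. Qed.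

Lemma Cauchy_Schwarz_Rintegral f g : f \in Lfun P 2%:E -> g \in Lfun P 2%:E ->
  (\int[P]_x (f x * g x)) ^+ 2 <=
  (\int[P]_x (f x ^+ 2)) * \int[P]_x (g x ^+ 2).
Proof.
move=> f2 g2.
have if2 : integrable (fun x => (f x ^+ 2)%:E) := Lfun2_integrable_sqr f2.
have ig2 : integrable (fun x => (g x ^+ 2)%:E) := Lfun2_integrable_sqr g2.
have ifg := integrable_mul f2 g2.
set S := \int[P]_x (f x ^+ 2); set B := \int[P]_x (f x * g x).
set C := \int[P]_x (g x ^+ 2).
have S0 : 0 <= S by apply: Rintegral_ge0 => x _; exact: sqr_ge0.
have C0 : 0 <= C by apply: Rintegral_ge0 => x _; exact: sqr_ge0.
have quad a : 0 <= a ^+ 2 * S - 2 * a * B + C.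
  have ia : integrable (fun x => (a ^+ 2 * f x ^+ 2)%:E).
    by under eq_fun do rewrite EFinM; exact: integrableZl.
  have ib : integrable (fun x => (2 * a * (f x * g x))%:E).
    by under eq_fun do rewrite EFinM; exact: integrableZl.
  have -> : a ^+ 2 * S - 2 * a * B + C =
      \int[P]_x (a ^+ 2 * f x ^+ 2 - 2 * a * (f x * g x) + g x ^+ 2).
    rewrite RintegralD//; last exact: integrableB ia ib.
    by rewrite RintegralB// !RintegralZl.
  apply: Rintegral_ge0 => x _.
  have -> : a ^+ 2 * f x ^+ 2 - 2 * a * (f x * g x) + g x ^+ 2 =
    (a * f x - g x) ^+ 2 by ring.
  exact: sqr_ge0.
move: S0; rewrite le_eqVlt => /predU1P[S0|S0].
  have [->|B0] := eqVneq B 0; first by rewrite expr0n/= mulr_ge0// -S0.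
  (* [S = 0] leaves an affine function of [a], equal to [-1] at this point. *)
  have := quad ((C + 1) / (2 * B)); rewrite -S0 mulr0.
  have -> : 2 * ((C + 1) / (2 * B)) * B = C + 1 by field.
  lra.
(* The minimum of the quadratic polynomial. *)
have := quad (B / S).
have -> : (B / S) ^+ 2 * S - 2 * (B / S) * B + C = C - B ^+ 2 / S by field; lra.
by rewrite subr_ge0 ler_pdivrMr// mulrC.
Qed.

Lemma Lfun2_subr_cst f c : f \in Lfun P 2%:E ->
  (fun x => f x - c) \in Lfun P 2%:E.
Proof.
move=> f2; have mf : measurable_fun setT f by move: f2 => /andP[]; rewrite !inE.
apply: integrable_sqr_Lfun2; first exact: measurable_funB.
have i1 : integrable (fun x => (2 * c * f x)%:E).
  under eq_fun do rewrite EFinM; apply: integrableZl => //.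
  exact: Lfun2_integrable.
have i2 := finite_measure_integrable_cst P (c ^+ 2) measurableT.
have i3 := integrableB measurableT (Lfun2_integrable_sqr f2) i1.
apply: eq_integrable (integrableD measurableT i3 i2) => // x _ /=.
by rewrite -EFinB -EFinD; congr EFin; ring.
Qed.

Lemma variance_center f (c := \int[P]_x f x) : f \in Lfun P 2%:E ->
  \int[P]_x ((f x - c) ^+ 2) = \int[P]_x (f x ^+ 2) - c ^+ 2.
Proof.
move=> f2.
have if2 : integrable (fun x => (f x ^+ 2)%:E) := Lfun2_integrable_sqr f2.
have if1 := Lfun2_integrable f2.
have i1 : integrable (fun x => (2 * c * f x)%:E).
  by under eq_fun do rewrite EFinM; exact: integrableZl.
have i2 := finite_measure_integrable_cst P (c ^+ 2) measurableT.
transitivity (\int[P]_x (f x ^+ 2 - 2 * c * f x + cst (c ^+ 2) x)).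
  by apply: eq_Rintegral => x _ /=; ring.
rewrite RintegralD//; last exact: integrableB if2 i1.
rewrite RintegralB// RintegralZl// Rintegral_probability_cst -/c.
by ring.
Qed.

Lemma sqr_Rintegral_le f : f \in Lfun P 2%:E ->
  (\int[P]_x f x) ^+ 2 <= \int[P]_x (f x ^+ 2).
Proof.
move=> f2; rewrite -subr_ge0 -variance_center//.
by apply: Rintegral_ge0 => x _; exact: sqr_ge0.
Qed.

End square_integrable.

(** * Means under two measures and the chi-square divergence *)

Section chi2_transfer.
Context d (X : measurableType d) (R : realType) (P Q : probability X R).
Implicit Types h : X -> R.
Local Open Scope charge_scope.
Local Open Scope ring_scope.

(** With [r] the density of [P] with respect to [Q], the difference of the means
    is the integral under [Q] of [(h - int h dQ) (r - 1)], to which the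
    Cauchy-Schwarz inequality applies. *)
Lemma chi2_mean_diff (M : R) h : (forall x, 0 <= h x) ->
  h \in Lfun Q 2%:E -> (chi2 P Q <= M%:E)%E ->
  P.-integrable setT (EFin \o h) /\
  (\int[P]_x h x - \int[Q]_x h x) ^+ 2 <=
    M * (\int[Q]_x (h x ^+ 2) - (\int[Q]_x h x) ^+ 2).
Proof.
move=> h0 h2; rewrite /chi2; case: asboolP => // PQ chiM.
pose r x := fine (('d (charge_of_finite_measure P) '/d Q) x).
have rE x : ('d (charge_of_finite_measure P) '/d Q) x = (r x)%:E.
  by rewrite /r fineK// Radon_Nikodym_fin_num.
have ir : Q.-integrable setT (EFin \o r).
  have : Q.-integrable setT ('d (charge_of_finite_measure P) '/d Q).
    exact: Radon_Nikodym_integrable.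
  by apply: eq_integrable => // x _; exact: rE.
have mr : measurable_fun setT r by apply/measurable_EFinP; exact: measurable_int ir.
have mh : measurable_fun setT h by move: h2 => /andP[]; rewrite !inE.
have intr : \int[Q]_x r x = 1.
  rewrite /Rintegral; under eq_integral do rewrite -rE.
  rewrite -Radon_Nikodym_integral//=.
  by have -> : P setT = 1%E := probability_setT P.
have chiE : (\int[Q]_x ((r x - 1) ^+ 2)%:E <= M%:E)%E.
  by apply: le_trans chiM; under [leRHS]eq_integral do rewrite rE.
have mr1 : measurable_fun setT (fun x => r x - 1) by exact: measurable_funB.
have ir2 : Q.-integrable setT (fun x => ((r x - 1) ^+ 2)%:E).
  apply/integrableP; split; first by apply/measurable_EFinP; exact: measurable_funX.
  under eq_integral do rewrite gee0_abs ?lee_fin ?sqr_ge0//.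
  exact: le_lt_trans chiE (ltry _).
have r2 := integrable_sqr_Lfun2 mr1 ir2.
have ihr1 := integrable_mul h2 r2.
have ih := Lfun2_integrable h2.
have ihr : Q.-integrable setT (fun x => (h x * r x)%:E).
  apply: eq_integrable (integrableD measurableT ihr1 ih) => // x _ /=.
  by rewrite -EFinD; congr EFin; ring.
have hP : (\int[P]_x (h x)%:E = \int[Q]_x (h x * r x)%:E)%E.
  have -> : (\int[P]_x (h x)%:E =
      \int[Q]_x ((h x)%:E * Radon_Nikodym_SigmaFinite.f P Q x))%E.
    apply/esym/(Radon_Nikodym_SigmaFinite.change_of_variables PQ
      (f := EFin \o h)) => //.
    exact/measurable_EFinP.
  apply: ae_eq_integral => //.
  - apply: emeasurable_funM; first exact/measurable_EFinP.
    exact: measurable_int (Radon_Nikodym_SigmaFinite.f_integrable PQ).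
  - exact: measurable_int ihr.
  under [X in ae_eq _ _ _ X]eq_fun do rewrite EFinM -rE.
  apply: ae_eqe_mul2l; exact: ae_eq_Radon_Nikodym_SigmaFinite.
have ihP : P.-integrable setT (EFin \o h).
  apply/integrableP; split; first exact/measurable_EFinP.
  under eq_integral do rewrite gee0_abs ?lee_fin//.
  rewrite /= hP; exact: integrable_lty ihr.
split=> //.
set mQ := \int[Q]_x h x.
have hc : (fun x => h x - mQ) \in Lfun Q 2%:E.
  exact: Lfun2_subr_cst.
have -> : \int[P]_x h x - mQ = \int[Q]_x ((h x - mQ) * (r x - 1)).
  have i1 : Q.-integrable setT (fun x => (mQ * (r x - 1))%:E).
    under eq_fun do rewrite EFinM; apply: integrableZl => //.
    exact: Lfun2_integrable r2.
  transitivity (\int[Q]_x (h x * (r x - 1) - mQ * (r x - 1))); last first.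
    by apply: eq_Rintegral => x _; ring.
  rewrite RintegralB// RintegralZl//; last exact: Lfun2_integrable r2.
  rewrite [X in _ - _ * X]RintegralB//; last first.
    exact: (finite_measure_integrable_cst Q 1 measurableT).
  rewrite intr Rintegral_probability_cst subrr mulr0 subr0.
  transitivity (\int[Q]_x (h x * r x - h x)); last first.
    by apply: eq_Rintegral => x _; ring.
  rewrite RintegralB//; congr (_ - _).
  by rewrite /Rintegral hP.
apply: (le_trans (Cauchy_Schwarz_Rintegral hc r2)).
rewrite mulrC.
rewrite variance_center//.
apply: ler_wpM2r.
  by rewrite subr_ge0; exact: sqr_Rintegral_le.
by rewrite -lee_fin /Rintegral fineK// integrable_fin_num.
Qed.

End chi2_transfer.

(** * Entropy *)

Section entropy.
Context d (X : measurableType d) (R : realType) (P : probability X R).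
Implicit Types u h : X -> R.
Local Notation integrable := (P.-integrable setT).

(** [u ln u] is bounded below by [-1], so only its positive part could fail to be
    integrable; an entropy below [+oo] excludes this. *)
Lemma xlnx_integrable u : (forall x, 0 <= u x) ->
  integrable (EFin \o u) -> (Ent P u < +oo)%E ->
  integrable (fun x => (u x * ln (u x))%:E).
Proof.
move=> u0 iu; rewrite /Ent.
have mu : measurable_fun setT u by apply/measurable_EFinP; exact: measurable_int iu.
have mw : measurable_fun setT (fun x => (u x * ln (u x))%:E).
  apply/measurable_EFinP/measurable_funM => //.
  exact: measurableT_comp.
have fu : (\int[P]_x (u x)%:E)%E \is a fin_num by apply: integrable_fin_num iu.
have fl : ((\int[P]_x (u x)%:E) * lne (\int[P]_x (u x)%:E))%E \is a fin_num.
  have /fineK <- := fu.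
  have : 0 <= fine (\int[P]_x (u x)%:E)%E.
    by rewrite fine_ge0// integral_ge0// => x _; rewrite lee_fin.
  rewrite le_eqVlt => /predU1P[<-|g0]; first by rewrite mul0e.
  by rewrite lne_EFin.
rewrite lteBlDr// => hw.
pose w x := (u x * ln (u x))%:E.
have iwn : integrable (w^\-)%E.
  apply: le_integrable (finite_measure_integrable_cst P 1 measurableT) => //.
    exact: measurable_funeneg.
  move=> x _; rewrite /= funenegE -EFinN -EFin_max !lee_fin normr1.
  have := xln_ge_tangent (u0 x) ltr01; rewrite ln1 => uw.
  by rewrite ger0_norm ?le_max ?lexx ?orbT// ge_max ler01 andbT; have := u0 x; lra.
have iwp : integrable (w^\+)%E.
  apply/integrableP; split; first exact: measurable_funepos.
  under eq_integral do rewrite gee0_abs//.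
  move: hw; rewrite -/w (integralE _ _ w) lteBlDr; last exact: integrable_fin_num iwn.
  move=> /lt_le_trans; apply; exact: leey.
rewrite -/w (funeposneg w); exact: integrableB.
Qed.

Lemma EntE u : (forall x, 0 <= u x) ->
  integrable (EFin \o u) -> integrable (fun x => (u x * ln (u x))%:E) ->
  Ent P u = (\int[P]_x (u x * ln (u x)) -
    (\int[P]_x u x) * ln (\int[P]_x u x))%:E.
Proof.
move=> u0 iu iw.
rewrite /Ent EFinB /Rintegral fineK; last exact: integrable_fin_num iw.
congr (_ - _)%E.
have fu : (\int[P]_x (u x)%:E)%E \is a fin_num by apply: integrable_fin_num iu.
have g0 : (0 <= \int[P]_x (u x)%:E)%E.
  by rewrite integral_ge0// => x _; rewrite lee_fin.
move: (\int[P]_x (u x)%:E)%E fu g0 => [g|//|//] _; rewrite lee_fin le_eqVlt/=.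
by move=> /predU1P[<-|g0]; [rewrite mul0e mul0r|rewrite leNgt g0].
Qed.

(** Integrated form of [h ln h >= h (ln a + 1) - a] multiplied by [2 h].  The best
    choice, [a = int h^2 / int h], says that [g ln (g / m^2) <= Ent (h^2)] for
    the first two moments [m] and [g] of [h]. *)
Lemma entropy_tangent h a : (forall x, 0 <= h x) ->
  integrable (EFin \o h) -> integrable (fun x => (h x ^+ 2)%:E) ->
  integrable (fun x => (h x ^+ 2 * ln (h x ^+ 2))%:E) -> 0 < a ->
  2 * ((\int[P]_x (h x ^+ 2)) * (ln a + 1) - a * \int[P]_x h x) <=
  \int[P]_x (h x ^+ 2 * ln (h x ^+ 2)).
Proof.
move=> h0 ih ih2 ihl a0.
have i1 : integrable (fun x => ((2 * (ln a + 1)) * h x ^+ 2)%:E).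
  by under eq_fun do rewrite EFinM; exact: integrableZl.
have i2 : integrable (fun x => (2 * a * h x)%:E).
  by under eq_fun do rewrite EFinM; exact: integrableZl.
have -> : 2 * ((\int[P]_x (h x ^+ 2)) * (ln a + 1) - a * \int[P]_x h x) =
    \int[P]_x ((2 * (ln a + 1)) * h x ^+ 2 - 2 * a * h x).
  by rewrite RintegralB// !RintegralZl//; ring.
apply: le_Rintegral => //; first exact: integrableB i1 i2.
move=> x _.
have := h0 x; rewrite le_eqVlt => /predU1P[<-|hx]; first by rewrite expr0n/=; lra.
rewrite lnXn// -mulr_natl.
have := xln_ge_tangent (ltW hx) a0.
rewrite -(ler_pM2l hx); lra.
Qed.

End entropy.

Section entropy_density.
Context d (X : measurableType d) (R : realType) (P : probability X R).
Implicit Types f : X -> R.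
Local Notation integrable := (P.-integrable setT).

(** The gap at [f^2] between [y ln y] and its tangent line at [A]. *)
Definition entropy_density (A : R) f x : R :=
  f x ^+ 2 * ln (f x ^+ 2) - f x ^+ 2 * ln A - f x ^+ 2 + A.

Lemma entropy_density_ge0 A f x : 0 < A -> 0 <= entropy_density A f x.
Proof.
move=> A0; have := xln_ge_tangent (sqr_ge0 (f x)) A0.
by rewrite /entropy_density; lra.
Qed.

Lemma entropy_density_measurable A f : measurable_fun setT f ->
  measurable_fun setT (fun x => (entropy_density A f x)%:E).
Proof.
move=> mf; have m2 := measurable_funX 2 mf.
apply/measurable_EFinP/measurable_funD => //.
apply: measurable_funB => //; apply: measurable_funB.
  by apply: measurable_funM => //; exact: measurableT_comp.
exact: measurable_funM.
Qed.

Lemma integral_entropy_density A f :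
  integrable (fun x => (f x ^+ 2)%:E) ->
  integrable (fun x => (f x ^+ 2 * ln (f x ^+ 2))%:E) ->
  (\int[P]_x (entropy_density A f x)%:E =
   (\int[P]_x (f x ^+ 2 * ln (f x ^+ 2)) - (\int[P]_x (f x ^+ 2)) * ln A -
   \int[P]_x (f x ^+ 2) + A)%:E)%E.
Proof.
move=> i2 il.
have i2A : integrable (fun x => (f x ^+ 2 * ln A)%:E).
  by under eq_fun do rewrite EFinM; exact: integrableZr.
have i3 : integrable (EFin \o (fun x => f x ^+ 2 * ln (f x ^+ 2) - f x ^+ 2 * ln A)).
  exact: integrableB il i2A.
have i4 : integrable (EFin \o
    (fun x => f x ^+ 2 * ln (f x ^+ 2) - f x ^+ 2 * ln A - f x ^+ 2)).
  exact: integrableB i3 i2.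
have iA := finite_measure_integrable_cst P A measurableT.
have i5 : integrable (EFin \o entropy_density A f) by exact: integrableD i4 iA.
transitivity (\int[P]_x entropy_density A f x)%:E.
  by rewrite /Rintegral fineK//; exact: integrable_fin_num i5.
congr EFin; rewrite /entropy_density RintegralD//.
by rewrite RintegralB// RintegralB// RintegralZr// Rintegral_probability_cst.
Qed.

(** Convexity of [y ln y] at the mean [g] of [f^2]: the integral of the density
    exceeds the entropy by [g ln g - g ln A - g + A >= 0].  The tangent at [e A]
    shows that [f^2] is dominated by the density plus a constant, so that a
    finite integral of the density entails that [f] is square-integrable. *)
Lemma Ent_le_integral_entropy_density (A B : R) f :
  measurable_fun setT f -> 0 < A ->
  (\int[P]_x (entropy_density A f x)%:E <= B%:E)%E ->
  f \in Lfun P 2%:E /\ (Ent P (fun x => f x ^+ 2)%R <= B%:E)%E.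
Proof.
move=> mf A0 hB; have m2 := measurable_funX 2 mf.
have e0 x := entropy_density_ge0 f x A0.
have iA (c : R) : integrable (fun=> c%:E).
  exact: (finite_measure_integrable_cst P c measurableT).
have iPhi : integrable (fun x => (entropy_density A f x)%:E).
  apply/integrableP; split; first exact: entropy_density_measurable.
  under eq_integral do rewrite gee0_abs ?lee_fin//.
  exact: le_lt_trans hB (ltry _).
have i2 : integrable (fun x => (f x ^+ 2)%:E).
  apply: le_integrable (integrableD measurableT iPhi (iA (A * expR 1))) => //.
    exact/measurable_EFinP.
  move=> x _; rewrite /= lee_fin.
  have c0 : 0 < A * expR 1 by rewrite mulr_gt0// expR_gt0.
  have h0 := addr_ge0 (e0 x) (ltW c0).
  rewrite (ger0_norm (sqr_ge0 _)) (ger0_norm h0).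
  have := xln_ge_tangent (sqr_ge0 (f x)) c0.
  rewrite lnM ?posrE ?expR_gt0// expRK /entropy_density.
  by lra.
have i2A : integrable (fun x => (f x ^+ 2 * (ln A + 1))%:E).
  by under eq_fun do rewrite EFinM; exact: integrableZr.
have il : integrable (fun x => (f x ^+ 2 * ln (f x ^+ 2))%:E).
  apply: eq_integrable (integrableB measurableT
    (integrableD measurableT iPhi i2A) (iA A)) => // x _ /=.
  by congr EFin; rewrite /entropy_density; ring.
split; first exact: integrable_sqr_Lfun2.
rewrite (EntE (fun x => sqr_ge0 (f x)) i2 il) lee_fin.
move: hB; rewrite integral_entropy_density// lee_fin.
have g0 : 0 <= \int[P]_x (f x ^+ 2) by apply: Rintegral_ge0 => x _; exact: sqr_ge0.
by have := xln_ge_tangent g0 A0; lra.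
Qed.

(** When all the means are [0], [(x^2 + y^2) / 2] is not positive; any [A > 0] is
    then suitable, at the price of the additional term [A]. *)
Lemma entropy_density_le (x y A e b : R) f : let m := \int[P]_x `|f x| in
  f \in Lfun P 2%:E -> (Ent P (fun x => f x ^+ 2)%R <= e%:E)%E ->
  0 <= x -> x <= m -> m <= y ->
  (m - x) ^+ 2 <= b -> (y - m) ^+ 2 <= b -> 0 < A ->
  A = (x ^+ 2 + y ^+ 2) / 2 \/ y = 0 ->
  (\int[P]_x (entropy_density A f x)%:E <= (2 * e + b + (y == 0)%:R * A)%:E)%E.
Proof.
move=> m f2 hE x0 xm my bx by_ A0 hA.
have mf : measurable_fun setT f by move: f2 => /andP[]; rewrite !inE.
have nE z : `|f z| ^+ 2 = f z ^+ 2 by rewrite real_normK// num_real.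
have i2 : integrable (fun x => (f x ^+ 2)%:E) := Lfun2_integrable_sqr f2.
have n2 : (fun z => `|f z|) \in Lfun P 2%:E.
  apply: integrable_sqr_Lfun2; first exact: measurableT_comp.
  by under eq_fun do rewrite nE.
have i1 := Lfun2_integrable n2.
have il := xlnx_integrable (fun x => sqr_ge0 (f x)) i2 (le_lt_trans hE (ltry _)).
move: hE; rewrite (EntE (fun x => sqr_ge0 (f x)) i2 il) lee_fin => hE.
rewrite integral_entropy_density// lee_fin.
set I := \int[P]_x (f x ^+ 2 * ln (f x ^+ 2)) in hE *.
set g := \int[P]_x (f x ^+ 2) in hE *.
have mg : m ^+ 2 <= g.
  by have := sqr_Rintegral_le n2; under [in leRHS]eq_Rintegral do rewrite nE.
have It a : 0 < a -> 2 * (g * (ln a + 1) - a * m) <= I.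
  have i2' : integrable (fun z => (`|f z| ^+ 2)%:E) by under eq_fun do rewrite nE.
  have il' : integrable (fun z => (`|f z| ^+ 2 * ln (`|f z| ^+ 2))%:E).
    by under eq_fun do rewrite nE.
  move=> /(entropy_tangent (fun z => normr_ge0 (f z)) i1 i2' il').
  have -> : \int[P]_z (`|f z| ^+ 2) = g by apply: eq_Rintegral => z _; rewrite nE.
  suff -> : \int[P]_z (`|f z| ^+ 2 * ln (`|f z| ^+ 2)) = I by [].
  by apply: eq_Rintegral => z _; rewrite nE.
have b0 : 0 <= b by apply: le_trans bx; exact: sqr_ge0.
have [y0|y0] := eqVneq y 0; last first.
  case: hA => [hA|/eqP]; last by rewrite (negbTE y0).
  rewrite mul0r addr0; exact: entropy_gap_le hA A0 x0 xm my mg bx by_ It hE.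
have m0 : m = 0 by lra.
rewrite mul1r.
have g0 : 0 <= g by apply: le_trans mg; exact: sqr_ge0.
have : I - g * ln A - g + A <= 2 * e + A.
  apply: entropy_gap_le_mean0 hE => // a a0.
  by have := It a a0; rewrite m0 mulr0 subr0.
lra.
Qed.

End entropy_density.

(** * Integration against a mixture *)

Section mixture_integral.
Context {dT dX : measure_display} {T : measurableType dT}
  {X : measurableType dX} {R : realType}.
Variables (mu : T -> probability X R) (mmu : measurable_family mu)
  (m : probability T R) (f : X -> \bar R).
Local Open Scope ereal_scope.

(** A kernel whose source has a unit factor: the form that composition of kernels
    requires for the mixture to be the composite of [m] and [mu]. *)
Definition family_kernel (_ : measurable_family mu) (p : unit * T) :
  {measure set X -> \bar R} := mu p.2.

Let measurable_family_kernel U : measurable U ->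
  measurable_fun setT (family_kernel mmu ^~ U).
Proof. by move=> mU; apply: measurableT_comp (mmu mU) _. Qed.

HB.instance Definition _ := isKernel.Build _ _ _ _ _ (family_kernel mmu)
  measurable_family_kernel.

Let family_kernel_prob p : family_kernel mmu p setT = 1.
Proof. exact: probability_setT. Qed.

HB.instance Definition _ := Kernel_isProbability.Build _ _ _ _ _
  (family_kernel mmu) family_kernel_prob.

Lemma measurable_integral_family : (forall x, 0 <= f x) ->
  measurable_fun setT f -> measurable_fun setT (fun t => \int[mu t]_x f x).
Proof.
move=> f0 mf; apply: (@measurable_fun_integral_kernel _ _ _ _ _ mu) => //.
Qed.

Lemma integral_mixture : (forall x, 0 <= f x) -> measurable_fun setT f ->
  \int[mixture m mmu]_x f x = \int[m]_t \int[mu t]_x f x.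
Proof.
move=> f0 mf.
rewrite -(integral_kcomp (kprobability (measurable_cst (m : pprobability T R)))
  (family_kernel mmu) tt f0 mf).
by apply: eq_measure_integral.
Qed.

End mixture_integral.

(** * The Poincare inequality *)

Section linearization.
Context d (X : measurableType d) (R : realType) (P : probability X R).
Implicit Types f g h : X -> R.
Local Notation integrable := (P.-integrable setT).

(** The integrand is a minorant of [t^-2] times the entropy density of [1 + t f]
    at [A = 1].  The integral of this density exceeds the entropy by at most
    the square of [int (1 + t f)^2 - 1 = t^2 int f^2]. *)
Let Ent_perturb f (t K : R) : f \in Lfun P 2%:E -> \int[P]_x f x = 0 -> 0 < t ->
  (Ent P (fun x => (1 + t * f x) ^+ 2)%R <= (t ^+ 2 * K)%:E)%E ->
  (\int[P]_x (Num.max 0 (2 * f x ^+ 2 - 10 * t * `|f x| ^+ 3))%:E <=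
   (K + t ^+ 2 * (\int[P]_x (f x ^+ 2)) ^+ 2)%:E)%E.
Proof.
move=> f2 f0 t0 hE.
have mf : measurable_fun setT f by move: f2 => /andP[]; rewrite !inE.
pose u x := (1 + t * f x) ^+ 2.
set v := \int[P]_x (f x ^+ 2).
have if2 : integrable (fun x => (f x ^+ 2)%:E) := Lfun2_integrable_sqr f2.
have if1 := Lfun2_integrable f2.
have i1 : integrable (fun x => (2 * t * f x)%:E).
  by under eq_fun do rewrite EFinM; exact: integrableZl.
have i2 : integrable (fun x => (t ^+ 2 * f x ^+ 2)%:E).
  by under eq_fun do rewrite EFinM; exact: integrableZl.
have i0 := finite_measure_integrable_cst P (1 : R) measurableT.
have uE : u = (fun x => cst 1 x + 2 * t * f x + t ^+ 2 * f x ^+ 2).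
  by apply/funext => x; rewrite /u/=; ring.
have i01 : integrable (EFin \o (fun x => cst 1 x + 2 * t * f x)).
  exact: integrableD i0 i1.
have iu : integrable (EFin \o u).
  by rewrite uE; exact: integrableD i01 i2.
have Iu : \int[P]_x u x = 1 + t ^+ 2 * v.
  rewrite uE RintegralD//.
  by rewrite RintegralD// !RintegralZl// Rintegral_probability_cst f0 mulr0 addr0.
have u0 x : 0 <= u x by exact: sqr_ge0.
have iul := xlnx_integrable u0 iu (le_lt_trans hE (ltry _)).
move: hE; rewrite (EntE u0 iu iul) Iu lee_fin => hE.
have v0 : 0 <= v by apply: Rintegral_ge0 => x _; exact: sqr_ge0.
have tv0 : 0 <= t ^+ 2 * v by rewrite mulr_ge0// sqr_ge0.
have iulB : integrable (EFin \o (fun x => u x * ln (u x) - u x)).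
  exact: integrableB iul iu.
have iul' : integrable (EFin \o (fun x => u x * ln (u x) - u x + cst 1 x)).
  exact: integrableD iulB i0.
have H : \int[P]_x (u x * ln (u x) - u x + cst 1 x) <= t ^+ 2 * (K + t ^+ 2 * v ^+ 2).
  rewrite RintegralD//.
  rewrite RintegralB// Rintegral_probability_cst Iu.
  have := ler_wpM2l (_ : 0 <= 1 + t ^+ 2 * v) (@ln_le_subr1 _ (1 + t ^+ 2 * v) _).
  by move=> /(_ ltac:(lra) ltac:(lra)); lra.
apply: (@le_trans _ _ ((t ^+ 2)^-1%:E *
    \int[P]_x (u x * ln (u x) - u x + cst 1 x)%:E)%E); last first.
  have -> : (\int[P]_x (u x * ln (u x) - u x + cst 1 x)%:E)%E =
      (\int[P]_x (u x * ln (u x) - u x + cst 1 x))%:E.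
    by rewrite /Rintegral fineK//; exact: integrable_fin_num iul'.
  by rewrite -EFinM lee_fin mulrC ler_pdivrMr ?exprn_gt0// mulrC.
have pt x : 0 <= u x * ln (u x) - u x + 1.
  by have := xln_ge_tangent (u0 x) ltr01; rewrite ln1; lra.
rewrite -ge0_integralZl//; last first.
- by rewrite lee_fin invr_ge0 sqr_ge0.
- by move=> x _; rewrite lee_fin.
- exact: measurable_int iul'.
apply: ge0_le_integral => //.
- by move=> x _; rewrite lee_fin le_max lexx.
- apply/measurable_EFinP/measurable_maxr => //; apply: measurable_funB.
    by apply: measurable_funM => //; exact: measurable_funX.
  apply: measurable_funM => //; apply: measurable_funX; exact: measurableT_comp.
- exact/measurable_funeM/(measurable_int _ iul').
move=> x _; rewrite -EFinM lee_fin ler_pdivlMl ?exprn_gt0//.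
rewrite maxr_pMr ?ge_max; last exact: sqr_ge0.
rewrite mulr0 pt/=.
have := xlnx_sqr_ge_cubic (t * f x); rewrite -/(u x) normrM gtr0_norm//.
lra.
Qed.

(** Pointwise, the entropy density of [1 + t f] at [A = 1] is equivalent to
    [2 t^2 f^2] as [t] tends to [0].  The minorants of [Ent_perturb] increase to
    [2 f^2] along [t = 1 / (n + 1)], so monotone convergence applies without
    any bound on [f]. *)
Lemma variance_le_of_Ent_linearization f (K : R) : f \in Lfun P 2%:E ->
  \int[P]_x f x = 0 ->
  (forall t : R, (0 < t)%R ->
    Ent P (fun x => (1 + t * f x) ^+ 2)%R <= (t ^+ 2 * K)%:E)%E ->
  2 * \int[P]_x (f x ^+ 2) <= K.
Proof.
move=> f2 f0 hE.
have mf : measurable_fun setT f by move: f2 => /andP[]; rewrite !inE.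
have if2 : integrable (fun x => (f x ^+ 2)%:E) := Lfun2_integrable_sqr f2.
set v := \int[P]_x (f x ^+ 2).
pose h (n : nat) x := Num.max 0 (2 * f x ^+ 2 - 10 * n.+1%:R^-1 * `|f x| ^+ 3).
have mh n : measurable_fun setT (EFin \o h n).
  apply/measurable_EFinP/measurable_maxr => //; apply: measurable_funB.
    by apply: measurable_funM => //; exact: measurable_funX.
  apply: measurable_funM => //; apply: measurable_funX; exact: measurableT_comp.
have h0 n x : 0 <= h n x by rewrite le_max lexx.
have ndh x : nondecreasing_seq (fun n => (h n x)%:E).
  move=> n k nk; rewrite lee_fin /h ge_max le_max lexx/=.
  rewrite le_max; apply/orP; right.
  rewrite lerD2l lerN2 ler_wpM2r ?exprn_ge0// ler_pM2l// lef_pV2 ?posrE//.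
  by rewrite ler_nat.
have cvgh x : (h n x)%:E @[n --> \oo] --> (2 * f x ^+ 2)%:E.
  apply: cvg_EFin; first exact: nearW.
  have -> : 2 * f x ^+ 2 = Num.max 0 (2 * f x ^+ 2 - 10 * 0 * `|f x| ^+ 3).
    by rewrite mulr0 mul0r subr0 max_r// mulr_ge0// sqr_ge0.
  pose F s : R := 2 * f x ^+ 2 - 10 * s * `|f x| ^+ 3.
  have Fc : continuous (fun s : R => Num.max 0 (F s)).
    apply: (@max_fun_continuous _ R R (cst 0)); first exact: cst_continuous.
    move=> s; rewrite /F; apply: cvgB; first exact: cvg_cst.
    by apply: cvgMr_tmp; apply: cvgMl_tmp.
  exact: (cvg_comp _ _ cvg_harmonic (Fc 0)).
have ndint : {homo (fun n => \int[P]_x (h n x)%:E)%E : n k /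
    (n <= k)%N >-> (n <= k)%E}.
  move=> n k nk; apply: ge0_le_integral => //.
  - by move=> x _; rewrite lee_fin.
  - exact: mh.
  - exact: mh.
  - by move=> x _; exact: ndh.
have hK n : (\int[P]_x (h n x)%:E <= K%:E)%E.
  apply/lee_addgt0Pr => e e0.
  pose k := maxn n (Num.bound (v ^+ 2 / e)).
  apply: (@le_trans _ _ (\int[P]_x (h k x)%:E)%E).
    exact/ndint/leq_maxl.
  have t0 : 0 < k.+1%:R^-1 :> R by rewrite invr_gt0.
  apply: le_trans (Ent_perturb f2 f0 t0 (hE _ t0)) _.
  rewrite -EFinD lee_fin lerD2l -/v.
  apply: (@le_trans _ _ (k.+1%:R^-1 * v ^+ 2)).
    rewrite ler_wpM2r ?sqr_ge0// expr2 ler_piMl ?invr_ge0//.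
    by rewrite invf_le1// ler1n.
  rewrite mulrC ler_pdivrMr// mulrC -ler_pdivrMr//.
  apply/ltW/(lt_le_trans (archi_boundP _)); first by rewrite divr_ge0 ?sqr_ge0// ltW.
  by rewrite ler_nat (leq_trans (leq_maxr n _))//.
rewrite -lee_fin.
have -> : (2 * v)%:E = (\int[P]_x (2 * f x ^+ 2)%:E)%E.
  rewrite -[v]/(fine _) EFinM fineK; last exact: integrable_fin_num if2.
  under [RHS]eq_integral do rewrite EFinM.
  by rewrite integralZl.
have -> : (\int[P]_x (2 * f x ^+ 2)%:E = \int[P]_x limn (fun n => (h n x)%:E))%E.
  by apply: eq_integral => x _; apply/esym/cvg_lim => //; exact: cvgh.
rewrite (@monotone_convergence _ _ _ P setT measurableT (fun n x => (h n x)%:E))//.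
- apply: lime_le; last exact: nearW.
  exact: ereal_nondecreasing_is_cvgn.
- by move=> n x _; rewrite lee_fin.
Qed.

End linearization.

Section poincare.
Context {R : realType} {d : nat}.
Implicit Types f : 'rV[R]_d -> R.
Implicit Types mu : probability (borel_rV R d) R.

Definition dirichlet_energy mu f := (\int[mu]_x (sqr_norm_gradient f x)%:E)%E.

Lemma continuous_borel_measurable f : continuous f ->
  measurable_fun setT (f : borel_rV R d -> R).
Proof.
move=> cf; apply: (measurability _ (RGenOInfty.measurableE R)).
move=> _ /= -[_ [r ->] <-]; rewrite setTI.
apply: sub_sigma_algebra.
by move/continuousP : cf; apply; exact: interval_open.
Qed.

Lemma C1_continuous f : C1 f -> continuous f.
Proof. by move=> [df _] x; exact: differentiable_continuous. Qed.

Lemma C1_measurable f : C1 f -> measurable_fun setT (f : borel_rV R d -> R).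
Proof. by move=> /C1_continuous; exact: continuous_borel_measurable. Qed.

Lemma sqr_norm_gradient_ge0 f x : 0 <= sqr_norm_gradient f x.
Proof. by apply: sumr_ge0 => i _; exact: sqr_ge0. Qed.

Lemma dirichlet_energy_ge0 mu f : (0 <= dirichlet_energy mu f)%E.
Proof.
by apply: integral_ge0 => x _; rewrite lee_fin sqr_norm_gradient_ge0.
Qed.

Lemma sqr_norm_gradient_measurable f : C1 f ->
  measurable_fun setT (sqr_norm_gradient f : borel_rV R d -> R).
Proof.
move=> [_ cf]; apply: continuous_borel_measurable.
apply: continuous_big => [|i _ x]; first exact: add_continuous.
have c : {for x, continuous (fun y => gradient f y ord0 i)}.
  apply: (@continuous_comp _ _ _ (gradient f) (fun M : 'rV[R]_d => M ord0 i)).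
    exact: cf.
  exact: coord_continuous.
exact: (cvgM c c).
Qed.

Lemma gradient_affine f (a t : R) x : differentiable f x ->
  gradient (fun y => a + t * f y) x = t *: gradient f x.
Proof.
move=> df; apply/rowP => i; rewrite !mxE.
have -> : (fun y => a + t * f y) = cst a + t \*: f by [].
have fd : derivable f x (delta_mx 0 i) by exact: diff_derivable.
rewrite deriveD; [|by []|exact: derivableZ].
by rewrite derive_cst add0r deriveZ.
Qed.

Lemma C1_affine f (a t : R) : C1 f -> C1 (fun y => a + t * f y).
Proof.
move=> [df cf]; split=> x.
  by apply: differentiableD => //; exact: differentiableZ.
have -> : gradient (fun y => a + t * f y) = (fun y => t *: gradient f y).
  by apply/funext => y; exact: gradient_affine.
apply: (@continuous_comp _ _ _ (gradient f) (fun v : 'rV[R]_d => t *: v)).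
  exact: cf.
exact: scaler_continuous.
Qed.

Lemma sqr_norm_gradient_affine f (a t : R) x : C1 f ->
  sqr_norm_gradient (fun y => a + t * f y) x =
  t ^+ 2 * sqr_norm_gradient f x.
Proof.
move=> [df _]; rewrite /sqr_norm_gradient gradient_affine// mulr_sumr.
by apply: eq_bigr => i _; rewrite mxE exprMn.
Qed.

(** The log-Sobolev inequality for [1 + t (f - c)], [c] the mean of [f], reads
    [Ent <= 2 C t^2 e]. *)
Lemma log_sobolev_poincare mu (C e : R) f : log_sobolev mu C -> C1 f ->
  dirichlet_energy mu f = e%:E ->
  \int[mu]_x (f x ^+ 2) - (\int[mu]_x f x) ^+ 2 <= C * e.
Proof.
move=> LS cf fe.
have [|f2 _] := LS f cf; first by rewrite -/(dirichlet_energy _ _) fe ltry.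
rewrite -variance_center//; set c := \int[mu]_x f x.
rewrite -(ler_pM2l (ltr0n R 2)).
apply: variance_le_of_Ent_linearization.
- exact: Lfun2_subr_cst.
- have i1 := Lfun2_integrable f2.
  have i2 := finite_measure_integrable_cst mu c measurableT.
  by rewrite RintegralB// Rintegral_probability_cst subrr.
move=> t t0.
have fE : (fun x => 1 + t * (f x - c)) = (fun x => (1 - t * c) + t * f x).
  by apply/funext => x; ring.
have gE : (\int[mu]_x (sqr_norm_gradient (fun x => 1 + t * (f x - c)) x)%:E =
    (t ^+ 2 * e)%:E)%E.
  rewrite fE; under eq_integral do rewrite sqr_norm_gradient_affine// EFinM.
  rewrite ge0_integralZl//.
  - by rewrite -/(dirichlet_energy _ _) fe -EFinM.
  - by apply/measurable_EFinP; exact: sqr_norm_gradient_measurable.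
  - by move=> x _; rewrite lee_fin sqr_norm_gradient_ge0.
  - by rewrite lee_fin sqr_ge0.
have [||_] := LS (fun x => 1 + t * (f x - c)).
- by rewrite fE; exact: C1_affine.
- by rewrite gE ltry.
rewrite gE -EFinM => /le_trans; apply.
by rewrite lee_fin; lra.
Qed.

End poincare.

(** * The log-Sobolev inequality for the mixture *)

Section log_sobolev_mixture.
Context {R : realType} {d : nat} {dT : measure_display} {T : measurableType dT}.
Variables (m : probability T R) (mu : T -> probability (borel_rV R d) R).
Variables (mmu : measurable_family mu) (C M : R).
Hypothesis C0 : 0 <= C.
Hypothesis M0 : 0 <= M.
Hypothesis LS : forall t, log_sobolev (mu t) C.
Hypothesis chiM : forall t t', (chi2 (mu t) (mu t') <= M%:E)%E.
Implicit Types f : 'rV[R]_d -> R.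

(** The constant [A] common to the whole family.  The means are compared only
    among the parameters of finite energy, since [f] need not be
    square-integrable under the other measures; [eps] accounts for the case
    where all these means vanish. *)
Lemma entropy_density_family_le f (eps : R) : C1 f -> 0 < eps ->
  (exists t, dirichlet_energy (mu t) f < +oo)%E ->
  exists2 A : R, 0 < A & forall t, (dirichlet_energy (mu t) f < +oo)%E ->
    (\int[mu t]_x (entropy_density A (f : borel_rV R d -> R) x)%:E <=
     (2 * (C * (2 + M / 2)))%:E * dirichlet_energy (mu t) f + eps%:E)%E.
Proof.
move=> cf eps0 [t0 t0y].
pose mean t := \int[mu t]_x `|f x|.
pose var t := \int[mu t]_x (f x ^+ 2) - mean t ^+ 2.
pose good t := (dirichlet_energy (mu t) f < +oo)%E.
have E0 t := dirichlet_energy_ge0 (mu t) f.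
have EE t : good t ->
    dirichlet_energy (mu t) f = (fine (dirichlet_energy (mu t) f))%:E.
  by move=> gt; rewrite fineK// ge0_fin_numE.
have f2 t : good t -> f \in Lfun (mu t) 2%:E by move=> /(LS cf)[].
have EntC t : good t ->
    (Ent (mu t) (fun x => f x ^+ 2)%R <=
     (2 * C * fine (dirichlet_energy (mu t) f))%:E)%E.
  move=> gt; have [_] := LS cf gt.
  by rewrite -/(dirichlet_energy (mu t) f) (EE _ gt) -EFinM.
have nE z : `|f z| ^+ 2 = f z ^+ 2 by rewrite real_normK// num_real.
have mf := C1_measurable cf.
have n2 t : good t -> (fun z => `|f z|) \in Lfun (mu t) 2%:E.
  move=> gt; apply: integrable_sqr_Lfun2; first exact: measurableT_comp.
  by under eq_fun do rewrite nE; exact: Lfun2_integrable_sqr (f2 _ gt).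
have varC t : good t -> var t <= C * fine (dirichlet_energy (mu t) f).
  move=> gt; apply: le_trans (log_sobolev_poincare (LS (t := t)) cf (EE _ gt)).
  rewrite lerB// -real_normK ?num_real// ler_sqr ?nnegrE//.
    apply: le_normr_Rintegral => //; exact: Lfun2_integrable (f2 _ gt).
  by apply: Rintegral_ge0.
have meanD t t' : good t -> (mean t' - mean t) ^+ 2 <= M * var t.
  move=> gt; have [_] := chi2_mean_diff
    (fun x : borel_rV R d => normr_ge0 (f x)) (n2 _ gt) (chiM t' t).
  by under [in leRHS]eq_Rintegral do rewrite nE.
have [|||x [y [x0 xy]]] := @dispersion_bounds _ _ good mean (fun t => M * var t) _ _ _.
- by exists t0.
- by move=> t _; exact: Rintegral_ge0.
- by move=> t t' gt _; exact: meanD.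
pose A := if y == 0 then eps else (x ^+ 2 + y ^+ 2) / 2.
have y0 : 0 <= y by have [xm my _ _] := xy t0 t0y; lra.
have A0 : 0 < A.
  rewrite /A; case: eqVneq => // yn0.
  by rewrite divr_gt0// ltr_wpDl ?sqr_ge0// exprn_gt0// lt_neqAle eq_sym yn0.
exists A => // t gt; have [xm my bx by_] := xy t gt.
rewrite (EE t gt) -EFinM -EFinD.
apply: le_trans (entropy_density_le (f2 t gt) (EntC t gt) x0 xm my bx by_ A0 _) _.
  by rewrite /A; case: eqVneq; [right|left].
rewrite lee_fin.
have : (y == 0)%:R * A <= eps.
  by rewrite /A; case: eqVneq => _; rewrite ?mul1r// mul0r ltW.
have := ler_wpM2l M0 (varC t gt).
lra.
Qed.

(** Almost every parameter has finite energy, so the bounds of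
    [entropy_density_family_le] may be integrated over the parameters. *)
Lemma log_sobolev_mixture : log_sobolev (mixture m mmu) (C * (2 + M / 2)).
Proof.
move=> f cf Ey.
have mG := sqr_norm_gradient_measurable cf.
have E0 t := dirichlet_energy_ge0 (mu t) f.
have mE : measurable_fun setT (fun t => dirichlet_energy (mu t) f).
  apply: measurable_integral_family => //.
  - by move=> x; rewrite lee_fin sqr_norm_gradient_ge0.
  - exact/measurable_EFinP.
have EE : (\int[mixture m mmu]_x (sqr_norm_gradient f x)%:E =
    \int[m]_t dirichlet_energy (mu t) f)%E.
  apply: integral_mixture.
  - by move=> x; rewrite lee_fin sqr_norm_gradient_ge0.
  - exact/measurable_EFinP.
rewrite EE in Ey *.
have iE : m.-integrable setT (fun t => dirichlet_energy (mu t) f).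
  by apply/integrableP; split => //; under eq_integral do rewrite gee0_abs//.
have aeE := integrable_ae measurableT iE.
have [t0 t0y] : (exists t, dirichlet_energy (mu t) f < +oo)%E.
  apply: contrapT => /forallNP h.
  move: Ey; rewrite (eq_integral (cst +oo%E)); last first.
    by move=> t _; apply/eqP; rewrite -leye_eq leNgt; apply/negP/h.
  by rewrite integral_probability_cst ltxx.
set E := (\int[m]_t dirichlet_energy (mu t) f)%E in Ey *.
have EfE : E = (fine E)%:E by rewrite fineK// ge0_fin_numE// integral_ge0.
have mf := C1_measurable cf.
set K := (2 * _)%:E.
have K0 : (0 <= K)%E.
  rewrite lee_fin; apply: mulr_ge0 => //; apply: mulr_ge0 => //.
  by rewrite addr_ge0// divr_ge0.
have key (eps : R) : 0 < eps -> f \in Lfun (mixture m mmu) 2%:E /\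
    (Ent (mixture m mmu) (fun x => f x ^+ 2)%R <= K * E + eps%:E)%E.
  move=> eps0.
  have [A A0 HA] := entropy_density_family_le cf eps0 (ex_intro _ t0 t0y).
  rewrite EfE -EFinM -EFinD.
  apply: (@Ent_le_integral_entropy_density _ _ _ _ A) => //.
  have Phi0 x : (0 <= (entropy_density A (f : borel_rV R d -> R) x)%:E)%E.
    by rewrite lee_fin entropy_density_ge0.
  have mPhi := entropy_density_measurable A mf.
  rewrite integral_mixture// EFinD EFinM -EfE.
  have -> : (K * E + eps%:E = \int[m]_t (K * dirichlet_energy (mu t) f + eps%:E))%E.
    rewrite ge0_integralD//.
    - by rewrite ge0_integralZl// integral_probability_cst.
    - by move=> t _; rewrite mule_ge0.
    - exact: measurable_funeM.
    - by move=> t _; rewrite lee_fin ltW.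
  apply: ae_ge0_le_integral => //.
  - by move=> t _; exact: integral_ge0.
  - exact: measurable_integral_family.
  - by move=> t _; rewrite adde_ge0// ?mule_ge0// lee_fin ltW.
  - by apply: emeasurable_funD => //; exact: measurable_funeM.
  by apply: filterS aeE => t /(_ I) tfin _; apply: HA; rewrite -ge0_fin_numE.
split; first by have [] := key 1 ltr01.
by apply/lee_addgt0Pr => e e0; have [] := key e e0.
Qed.

End log_sobolev_mixture.

Section mixture_constant.
Context {R : realType} {d : nat} {dT : measure_display} {T : measurableType dT}.
Variables (m : probability T R) (mu : T -> probability (borel_rV R d) R).
Variable mmu : measurable_family mu.

Lemma log_sobolev_of_C_LS_lt (P : probability (borel_rV R d) R) (C : R) :
  (C_LS P < C%:E)%E -> log_sobolev P C.
Proof.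
move=> /ereal_inf_lt[_ [C' [C'0 LS'] <-]]; rewrite lte_fin => C'C f cf fy.
have [f2 hf] := LS' f cf fy; split=> //; apply: le_trans hf _.
apply: lee_wpmul2r; first exact: dirichlet_energy_ge0.
by rewrite lee_fin ler_pM2l// ltW.
Qed.

Lemma C_LS_ge0 (P : probability (borel_rV R d) R) : (0 <= C_LS P)%E.
Proof. by apply: le_ereal_inf_tmp => _ [C [C0 _] <-]; rewrite lee_fin ltW. Qed.

(** The infimum [c] need not be attained, hence the passage through [c + e / k]. *)
Lemma C_LS_mixture_le (c M : R) : 0 <= c -> 0 <= M ->
  (forall t, (C_LS (mu t) <= c%:E)%E) ->
  (forall t t', (chi2 (mu t) (mu t') <= M%:E)%E) ->
  (C_LS (mixture m mmu) <= (c * (2 + M / 2))%:E)%E.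
Proof.
move=> c0 M0 CLSc chiM; set k := 2 + M / 2.
have k0 : 0 < k by rewrite /k; lra.
apply/lee_addgt0Pr => e e0.
have ek : 0 < e / k by rewrite divr_gt0.
pose C := c + e / k.
have C0 : 0 < C by rewrite /C; lra.
have LS t : log_sobolev (mu t) C.
  apply: log_sobolev_of_C_LS_lt; apply: le_lt_trans (CLSc t) _.
  by rewrite lte_fin /C; lra.
have -> : (c * k)%:E + e%:E = (C * k)%:E :> \bar R.
  by rewrite -EFinD /C mulrDl divfK// gt_eqF.
apply: ereal_inf_lbound; exists (C * k) => //; split; first exact: mulr_gt0.
exact: log_sobolev_mixture (ltW C0) M0 LS chiM.
Qed.

End mixture_constant.

Local Open Scope ereal_scope.

Theorem proposition2p2 (R : realType) (d : nat)
    (dTheta : measure_display) (Theta : measurableType dTheta)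
    (m : probability Theta R)
    (mu : Theta -> probability (borel_rV R d) R)
    (mmu : measurable_family mu) :
  let C_Theta := ereal_sup [set C_LS (mu theta) | theta in [set: Theta]] in
  let M_Theta := ereal_sup [set chi2 (mu theta) (mu theta') |
                              theta in [set: Theta] & theta' in [set: Theta]] in
  C_Theta < +oo ->
  M_Theta < +oo ->
  C_LS (mixture m mmu) <=
    C_Theta * (2 + 4^-1%:E * (2 + M_Theta) * lne (1 + M_Theta)).
Proof.
set c := ereal_sup _; set M := ereal_sup _ => /= cy My.
have [t0 _] : [set: Theta] !=set0.
  apply/set0P/eqP => T0; have := probability_setT m.
  by rewrite T0 measure0 => /eqP; rewrite eq_sym onee_eq0.
have chi0 t t' : 0 <= chi2 (mu t) (mu t').
  rewrite /chi2; case: ifP => // _; apply: integral_ge0 => x _.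
  by rewrite expe2 sqre_ge0.
have CLSc t : C_LS (mu t) <= c by apply: ereal_sup_ubound; exists t.
have chiM t t' : chi2 (mu t) (mu t') <= M.
  by apply: ereal_sup_ubound; exists t => //; exists t'.
have c0 : 0 <= c := le_trans (C_LS_ge0 (mu t0)) (CLSc t0).
have M0 : 0 <= M := le_trans (chi0 t0 t0) (chiM t0 t0).
clearbody c M.
move: c M cy My c0 M0 chiM CLSc => [c||]// [M||]// _ _.
rewrite !lee_fin => c0 M0 chiM CLSc.
have M1 : (0 < 1 + M)%R by lra.
have -> : lne (1 + M%:E)%E = (ln (1 + M)%R)%:E by exact: (lne_EFin M1).
pose k : R := (2 + 4^-1 * (2 + M) * ln (1 + M))%R.
rewrite -[leRHS]/((c * k)%R%:E).
apply: le_trans (C_LS_mixture_le m mmu c0 M0 CLSc chiM) _.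
rewrite lee_fin ler_wpM2l//.
by have := ln1p_ge M0; rewrite /k; lra.
Qed.
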